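(* Let $e_1,e_2,e_3\in\mathbb{Z}[t]$ and let $E=E(t): y^2=(x-e_1)(x-e_2)(x-e_3)$ be a nonconstant elliptic curve over $\mathbb{Q}(t)$. Let $t_0\in\mathbb{Q}$ be such that the specialization $E(t_0)$ of $E(t)$ is an elliptic curve over $\mathbb{Q}$. Assume that $t_0$ satisfies the following condition: for every nonconstant square-free divisor $h$ in $\mathbb{Z}[t]$ of $(e_1-e_2)(e_1-e_3)$, or of $(e_2-e_1)(e_2-e_3)$, or of $(e_3-e_1)(e_3-e_2)$, the rational number $h(t_0)$ is not a square in $\mathbb{Q}$. Then the specialization homomorphism $\sigma: E(\mathbb{Q}(t))\to E(t_0)(\mathbb{Q})$ is injective.
   Context: An elliptic curve over $\mathbb{Q}(t)$ is nonconstant (non-isotrivial) if it is not isomorphic over $\mathbb{Q}(t)$ to an elliptic curve defined over $\mathbb{Q}$. The specialization $E(t_0)$ is the curve obtained by substituting $t=t_0$ in the coefficients; it is an elliptic curve when $(e_1-e_2)(e_2-e_3)(e_3-e_1)(t_0)\neq 0$. The specialization homomorphism $\sigma=\sigma_{t_0}$ sends a point of $E(\mathbb{Q}(t))$ to the point of $E(t_0)(\mathbb{Q})$ obtained by evaluating its (projective) coordinates at $t=t_0$ (points whose $x$-coordinate has a pole at $t_0$ go to the point at infinity $O$). Divisibility and square-freeness are taken in the UFD $\mathbb{Z}[t]$. *)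

(* Defs.v *)
From HB Require Import structures.
From mathcomp Require Import all_boot all_order all_algebra.
From mathcomp Require Import fraction.
Set Implicit Arguments. Unset Strict Implicit. Unset Printing Implicit Defensive.
Import Order.TTheory GRing.Theory Num.Theory.
Local Open Scope ring_scope.

Notation Qt := {fraction {poly rat}}.

Definition zpoly_to_Qt (e : {poly int}) : Qt := @FracField.tofrac _ (map_poly intr e : {poly rat}).
Definition rat_to_Qt (c : rat) : Qt := @FracField.tofrac _ (c%:P).

(** Value of a rational function f at t0: None if f has a pole at t0,
    Some v otherwise.  Computed from a representative p/q of f reduced by
    gcd, so that numerator and denominator are coprime. *)
Definition fev (t0 : rat) (f : Qt) : option rat :=
  let p := \n_(repr f) in
  let q := \d_(repr f) in
  let g := gcdp p q in
  let p' := p %/ g in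
  let q' := q %/ g in
  if q'.[t0] == 0 then None else Some (p'.[t0] / q'.[t0]).

(** Points (affine points and the point at infinity = None) of
    y^2 = (x - e1)(x - e2)(x - e3) over a field K. *)
Definition on_curve (K : fieldType) (e1 e2 e3 : K) (P : option (K * K)) : Prop :=
  match P with
  | None => True
  | Some (x, y) => y ^+ 2 = (x - e1) * (x - e2) * (x - e3)
  end.

Definition specialize (t0 : rat) (P : option (Qt * Qt)) : option (rat * rat) :=
  match P with
  | None => None
  | Some (x, y) =>
      match fev t0 x, fev t0 y with
      | Some a, Some b => Some (a, b)
      | _, _ => None
      end
  end.

(** Discriminant of a general Weierstrass equation
    y^2 + a1 xy + a3 y = x^3 + a2 x^2 + a4 x + a6. *)
Definition weier_disc (R : comPzRingType) (a1 a2 a3 a4 a6 : R) : R :=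
  let b2 := a1 ^+ 2 + 4%:R * a2 in
  let b4 := 2%:R * a4 + a1 * a3 in
  let b6 := a3 ^+ 2 + 4%:R * a6 in
  let b8 := a1 ^+ 2 * a6 + 4%:R * a2 * a6 - a1 * a3 * a4 + a2 * a3 ^+ 2 - a4 ^+ 2 in
  - b2 ^+ 2 * b8 - 8%:R * b4 ^+ 3 - 27%:R * b6 ^+ 2 + 9%:R * b2 * b4 * b6.

(** The Weierstrass equation with coefficients a_i over K is transformed into
    the one with coefficients a'_i by the change of variables
    x = u^2 x' + r, y = u^3 y' + s u^2 x' + w  (Silverman, Table 3.1). *)
Definition weier_iso (K : fieldType) (a1 a2 a3 a4 a6 a1' a2' a3' a4' a6' : K) : Prop :=
  exists u r s w : K,
    u != 0 /\
    u * a1' = a1 + 2%:R * s /\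
    u ^+ 2 * a2' = a2 - s * a1 + 3%:R * r - s ^+ 2 /\
    u ^+ 3 * a3' = a3 + r * a1 + 2%:R * w /\
        u ^+ 4 * a4' = a4 - s * a3 + 2%:R * r * a2 - (w + r * s) * a1
                        + 3%:R * r ^+ 2 - 2%:R * s * w /\
        u ^+ 6 * a6' = a6 + r * a4 + r ^+ 2 * a2 + r ^+ 3 - w * a3 - w ^+ 2
                        - r * w * a1.

(** E : y^2 = (x-e1)(x-e2)(x-e3) over Q(t) is constant (isotrivial in the
    sense of the paper) if it is isomorphic over Q(t) to an elliptic curve
    defined over Q. *)
Definition constant_curve (e1 e2 e3 : {poly int}) : Prop :=
  let E1 := zpoly_to_Qt e1 in
  let E2 := zpoly_to_Qt e2 in
  let E3 := zpoly_to_Qt e3 in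
  exists b1 b2 b3 b4 b6 : rat,
    weier_disc b1 b2 b3 b4 b6 != 0 /\
    weier_iso 0 (- (E1 + E2 + E3)) 0 (E1 * E2 + E1 * E3 + E2 * E3) (- (E1 * E2 * E3))
      (rat_to_Qt b1) (rat_to_Qt b2) (rat_to_Qt b3) (rat_to_Qt b4) (rat_to_Qt b6).

(** Divisibility in the UFD Z[t] (not the pseudo-division of polydiv). *)
Definition zdvd (h D : {poly int}) : Prop := exists q : {poly int}, D = h * q.

Definition zsquarefree (h : {poly int}) : Prop :=
  h != 0 /\ forall g : {poly int}, zdvd (g * g) h -> g \is a GRing.unit.

Definition zeval (h : {poly int}) (t0 : rat) : rat := (map_poly intr h).[t0].

Definition is_square_rat (r : rat) : Prop := exists s : rat, s ^+ 2 = r.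

(* Main.v *)
Require Import Defs.
From HB Require Import structures.
From mathcomp Require Import all_boot all_order all_algebra all_field.
From mathcomp Require Import fraction ring zify.
From Stdlib Require Import Classical.
Import Order.TTheory GRing.Theory Num.Theory.
Local Open Scope ring_scope.

(** Call [(x, y)] a kernel point if [x] has a pole at [t0].
    (1) Descent: if [x = l / k] in lowest terms in Z[t], the squarefree part [h]
    of [l - e_i k] divides [(e_i - e_j)(e_i - e_k)], and at a pole [h(t0)] is,
    up to the sign of [k], a square.  By hypothesis [h] is constant, so
    [x - e_i = r_i ^ 2] in Q(t) with [r_i = C_i / B].
    (2) Choosing the signs so that the [r_i] agree to leading order at [t0],
    the half of [(x, y)] given by [x' - e_1 = (r_1 + r_2)(r_1 + r_3)], etc., is
    again a kernel point.  Iterating, [B'] divides [B], hence [B] is eventually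
    constant; then [C_i ^ 2] divides [(e_i - e_j)(e_i - e_k)], so the [C_i]
    take finitely many values up to scalars.  Two terms with proportional
    [C_1] and [C_2] have the same squares [C_i ^ 2], contradicting
    [C_i(t0) ^ 2 = 4 ^ n c].  So there is no kernel point.
    (3) If two distinct affine points have the same specialization, their
    difference is a kernel point. *)

(** * Divisibility, coprimality and squarefree parts in Z[t] *)

(** Gauss's lemma: on integer polynomials [%|] is divisibility over Q, and since contents are
    multiplicative, only the contents remain to be compared. *)
Lemma zdvd_contents (p q : {poly int}) :
  zdvd p q <-> (p %| q) /\ (zcontents p %| zcontents q)%Z.
Proof.
split=> [[r ->]|[/dvdpP_int [s ->]]]; first by rewrite dvdp_mulIl zcontentsM dvdz_mulr.
have [->|p0] := eqVneq p 0.
  by rewrite zprimitive0 mul0r => _; exists 0; rewrite mul0r.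
rewrite zcontentsM zcontents_primitive p0 mul1r => /dvdzP [m Dm].
exists (m *: zprimitive s); rewrite {1}[s]zpolyEprim {2}[p]zpolyEprim Dm.
by rewrite -!scalerAl -!scalerAr !scalerA mulrC.
Qed.

(** Coprimality is encoded as the conclusion of Euclid's lemma, because coprime elements of Z[t],
    such as 2 and t, need not satisfy a Bezout identity. *)
Definition zcoprime (p q : {poly int}) := forall w, zdvd p (q * w) -> zdvd p w.

(** The gcd in Z[t] is the primitive gcd over Q times the gcd [c] of the remaining contents. The
    cofactors are then coprime over Q and have coprime contents, and Gauss's lemma for each aspect
    yields [zcoprime]. *)
Lemma zgcd_split (p q : {poly int}) : p != 0 ->
  exists g k l : {poly int}, [/\ p = g * k, q = g * l, coprimep k l
    & zcoprime k l].
Proof.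
move=> p0.
have [p1 Dp] := dvdpP_int (dvdp_gcdl p q).
have [q1 Dq] := dvdpP_int (dvdp_gcdr p q).
set d := gcdp p q in Dp Dq; set G := zprimitive d in Dp Dq.
have d0 : d != 0 by rewrite gcdp_eq0 negb_and p0.
have G0 : G != 0 by rewrite zprimitive_eq0.
have p10 : p1 != 0 by apply: contraNneq p0 => p10; rewrite Dp p10 mulr0.
have Gd : G %= d.
  rewrite [X in _ %= X]zpolyEprim eqp_sym; apply: eqp_scale.
  by rewrite zcontents_eq0.
have co1 : coprimep p1 q1.
  have : G * gcdp p1 q1 %= G * 1.
    rewrite mulr1 (eqp_rtrans Gd) eqp_sym.
    by rewrite /d {1}Dp {1}Dq -/d; apply: gcdp_mul2l.
  by rewrite eqp_mul2l // -gcdp_eqp1.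
pose c := gcdz (zcontents p1) (zcontents q1).
have c0 : c != 0 by rewrite gcdz_eq0 negb_and zcontents_eq0 p10.
pose k := (zcontents p1 %/ c)%Z *: zprimitive p1.
pose l := (zcontents q1 %/ c)%Z *: zprimitive q1.
have Dk : p1 = c *: k by rewrite scalerA mulrC divzK ?dvdz_gcdl // -zpolyEprim.
have Dl : q1 = c *: l by rewrite scalerA mulrC divzK ?dvdz_gcdr // -zpolyEprim.
have ck : zcontents k = (zcontents p1 %/ c)%Z.
  by rewrite zcontentsZ zcontents_primitive p10 mulr1.
have cokl : coprimep k l by move: co1; rewrite Dk Dl coprimepZl // coprimepZr.
have coz : coprimez (zcontents k) (zcontents l).
  rewrite /coprimez -(inj_eq (mulfI c0)) mulr1.
  have -> : c * gcdz (zcontents k) (zcontents l)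
     = gcdz (c * zcontents k) (c * zcontents l).
    by rewrite -mulz_gcdr.
  by rewrite -!zcontentsZ -Dk -Dl.
exists (c *: G), k, l; split=> //.
- by rewrite -scalerAl scalerAr -Dk.
- by rewrite -scalerAl scalerAr -Dl.
move=> w /zdvd_contents []; rewrite Gauss_dvdpr // zcontentsM Gauss_dvdzr //.
by move=> h1 h2; apply/zdvd_contents.
Qed.

(** Dividing out the square of a nonunit [g] lowers the size if [g] is nonconstant, and the absolute
    leading coefficient if [g] is a constant other than 1 and -1; hence the measure of the
    induction. *)
Lemma zsquarefree_factor (u : {poly int}) : u != 0 ->
  exists h s : {poly int}, u = h * s ^+ 2 /\ zsquarefree h.
Proof.
have [n] := ubnP (size u + `|lead_coef u|)%N.
elim: n u => // n IHn u leun u0.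
have [[g [[q Du] gNu]]|sq] := classic (exists g : {poly int},
  zdvd (g * g) u /\ g \isn't a GRing.unit); last first.
  exists u, 1; rewrite expr1n mulr1; split=> //; split=> // g dg.
  by apply/negPn/negP => gNu; apply: sq; exists g.
have [g0 q0] : g != 0 /\ q != 0.
  by split; apply: contraNneq u0 => E; rewrite Du E ?(mulr0, mul0r).
have [h [s [Dq sqh]]] : exists h s : {poly int}, q = h * s ^+ 2 /\ zsquarefree h.
  apply: IHn (q0); rewrite -ltnS; apply: leq_trans leun; rewrite ltnS.
  rewrite Du !size_mul ?mulf_neq0 // !lead_coefM !abszM.
  have lg : (0 < `|lead_coef g|)%N by rewrite absz_gt0 lead_coef_eq0.
  have lq : (0 < `|lead_coef q|)%N by rewrite absz_gt0 lead_coef_eq0.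
  have sg : (0 < size g)%N by rewrite size_poly_gt0.
  have [sg1|sg1] := ltnP 1 (size g).
    rewrite -addSn; apply: leq_add; last by rewrite leq_pmull // muln_gt0 lg.
    by move: (size g) (size q) sg1 => a b; lia.
  have /eqP sgE : size g == 1%N by rewrite eqn_leq sg1 sg.
  rewrite sgE /= -addnS leq_add2l ltn_Pmull //.
  have /size_poly1P [c c0 Dg] : size g == 1%N by rewrite sgE.
  move: gNu lg; rewrite poly_unitE sgE eqxx Dg coefC lead_coefC /=.
  rewrite -[c \is a _]/((c == 1) || (c == -1)); lia.
exists h, (g * s); split=> //; rewrite Du Dq; ring.
Qed.

Lemma zdvd_sqr (s z : {poly int}) : s != 0 -> zdvd (s ^+ 2) (z ^+ 2) -> zdvd s z.
Proof.
move=> s0 [r Dz]; have [g [k [l [Ds Dl _ kl]]]] := zgcd_split s z s0.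
have g0 : g != 0 by apply: contraNneq s0 => E; rewrite Ds E mul0r.
have Dll : l * l = k * (k * r).
  apply: (mulfI (expf_neq0 2 g0)); move: Dz; rewrite Ds Dl => Dz.
  have -> : g ^+ 2 * (l * l) = (g * l) ^+ 2 by ring.
  rewrite Dz; ring.
have [|m Dm] := kl 1; first by rewrite mulr1; apply: kl; exists (k * r).
by exists (m * l); rewrite Dl Ds mulrA -(mulrA g) -Dm mulr1.
Qed.

(** Write h = g k and z = g l with k, l coprime. Then k divides l^2 g, hence g, so k^2 divides h and
    k is a unit. *)
Lemma zsquarefree_dvd_sqr (h z : {poly int}) :
  zsquarefree h -> zdvd h (z ^+ 2) -> zdvd h z.
Proof.
move=> [h0 sqh] [r Dz]; have [g [k [l [Dh Dl _ kl]]]] := zgcd_split h z h0.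
have g0 : g != 0 by apply: contraNneq h0 => E; rewrite Dh E mul0r.
have [m Dm] : zdvd k g.
  apply: (kl); apply: (kl); exists r; apply: (mulfI g0).
  have -> : g * (l * (l * g)) = (g * l) ^+ 2 by ring.
  rewrite -Dl Dz Dh; ring.
have ku : k \is a GRing.unit by apply: sqh; exists m; rewrite Dh Dm; ring.
by exists (k^-1 * l); rewrite Dh Dl -mulrA mulVKr.
Qed.

(** Cancelling s^2 makes h w the square of some r; the squarefree h divides r, so h^2 divides h
    w. *)
Lemma zsquarefree_part_cofactor (h s w z : {poly int}) :
  s != 0 -> zsquarefree h -> h * s ^+ 2 * w = z ^+ 2 ->
  zdvd h w /\ exists r : {poly int}, h * w = r ^+ 2.
Proof.
move=> s0 sqh E; have [r Dz] : zdvd s z.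
  by apply: zdvd_sqr => //; exists (h * w); rewrite -E; ring.
have hw : h * w = r ^+ 2.
  apply: (mulfI (expf_neq0 2 s0)); rewrite -exprMn -Dz -E; ring.
split; last by exists r.
have [|k Dk] := zsquarefree_dvd_sqr h r sqh; first by exists w.
exists (k ^+ 2); apply: (mulfI (proj1 sqh)); rewrite hw Dk; ring.
Qed.

Lemma zsquarefree_unit (c h : {poly int}) :
  c \is a GRing.unit -> zsquarefree h -> zsquarefree (c * h).
Proof.
move=> cu [h0 sqh]; split; first by rewrite mulrI_eq0 //; apply: mulrI.
move=> g [q Dq]; apply: sqh; exists (c^-1 * q).
by rewrite mulrCA -Dq mulKr.
Qed.

(** * Descent: square classes of the factors [l - e_i k] *)

Notation ZtoQ := (map_poly (intr : int -> rat)).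

Lemma zcoprime_subM (k l e : {poly int}) :
  k != 0 -> zcoprime k l -> zcoprime (l - e * k) k.
Proof.
move=> k0 kl w [v Dv]; have [v' Dv'] : zdvd k v.
  by apply: kl; exists (w + e * v); rewrite mulrDr Dv; ring.
by exists v'; apply: (mulfI k0); rewrite Dv Dv'; ring.
Qed.

Lemma zcoprime_dvdl (h m k : {poly int}) :
  m != 0 -> zcoprime (h * m) k -> zcoprime h k.
Proof.
move=> m0 co w [v Dv]; have [n Dn] : zdvd (h * m) (w * m).
  by apply: co; exists v; rewrite mulrA Dv; ring.
by exists n; apply: (mulIf m0); rewrite Dn; ring.
Qed.

Lemma zevalM p q t0 : zeval (p * q) t0 = zeval p t0 * zeval q t0.
Proof. by rewrite /zeval rmorphM hornerM. Qed.

Lemma zevalX p n t0 : zeval (p ^+ n) t0 = zeval p t0 ^+ n.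
Proof. by rewrite /zeval rmorphXn horner_exp. Qed.

Lemma zevalB p q t0 : zeval (p - q) t0 = zeval p t0 - zeval q t0.
Proof. by rewrite /zeval rmorphB hornerD hornerN. Qed.

Lemma zeval_unit h t0 : h \is a GRing.unit -> zeval h t0 != 0.
Proof.
move=> hu; have := congr1 (zeval^~ t0) (mulrV hu).
rewrite zevalM {3}/zeval rmorph1 hornerC => E.
by apply/eqP => h0; move/eqP: E; rewrite h0 mul0r eq_sym oner_eq0.
Qed.

Lemma coprimep_subM (F : fieldType) (k l e : {poly F}) :
  coprimep k l -> coprimep k (l - e * k).
Proof. by rewrite -mulNr addrC coprimep_addl_mul. Qed.

Lemma coprimep_ZtoQ (k l : {poly int}) : coprimep k l -> coprimep (ZtoQ k) (ZtoQ l).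
Proof.
move=> /Bezout_coprimepP [[u v] /= E]; apply/Bezout_coprimepP.
exists (ZtoQ u, ZtoQ v) => /=; rewrite -!rmorphM -rmorphD /= -(rmorph1 ZtoQ).
by rewrite /eqp !dvdp_rat_int.
Qed.

(* Here [x = l / k] in lowest terms in Z[t]; the coprimality forces [k] to be
   a unit times a square. *)
Lemma denominator_square (e1 e2 e3 k l z : {poly int}) :
  k != 0 -> zcoprime k l ->
  (l - e1 * k) * (l - e2 * k) * (l - e3 * k) * k = z ^+ 2 ->
  exists h0 s0 r : {poly int}, [/\ k = h0 * s0 ^+ 2, h0 \is a GRing.unit
    & h0 * ((l - e1 * k) * (l - e2 * k) * (l - e3 * k)) = r ^+ 2].
Proof.
move=> k0 kl Dz; have [h0 [s0 [Dk sqh]]] := zsquarefree_factor k k0.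
have s00 : s0 != 0 by apply: contraNneq k0 => E; rewrite Dk E expr0n mulr0.
have [|[m Dm] [r Dr]] := zsquarefree_part_cofactor h0 s0
  ((l - e1 * k) * (l - e2 * k) * (l - e3 * k)) z s00 sqh.
  by rewrite -Dk mulrC.
 exists h0, s0, r; split=> //.
(* Since [h0] divides the product of the [l - e_i k], [k] divides s0^2 times that product, which is
   s0^2 l^3 modulo [k]; coprimality strips [l] three times. Then h0 s0^2 divides s0^2, so [h0] is a
   unit. *)
have [n Dn] : zdvd k (s0 ^+ 2).
  do 3!apply: (kl).
  exists (m + s0 ^+ 2 * (e1 * l ^+ 2 + e2 * l ^+ 2 + e3 * l ^+ 2
     - k * l * (e1 * e2 + e1 * e3 + e2 * e3) + k ^+ 2 * (e1 * e2 * e3))).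
  have -> : l * (l * (l * s0 ^+ 2)) = s0 ^+ 2 * ((l - e1 * k) * (l - e2 * k) * (l - e3 * k))
     + k * s0 ^+ 2 * (e1 * l ^+ 2 + e2 * l ^+ 2 + e3 * l ^+ 2
     - k * l * (e1 * e2 + e1 * e3 + e2 * e3) + k ^+ 2 * (e1 * e2 * e3)) by ring.
  have Ek : s0 ^+ 2 * (h0 * m) = k * m by rewrite Dk; ring.
  by rewrite Dm Ek; ring.
apply/unitrPr; exists n; apply: (mulfI (expf_neq0 2 s00)).
by rewrite mulr1 [RHS]Dn Dk; ring.
Qed.

(** The hypothesis on divisors is applied to [h0 * h], with [h] the squarefree part of [l - e k]: it
    divides (e - e')(e - e'') and is a square at [t0], so it is constant. *)
Lemma factor_square (e e' e'' k l h0 r : {poly int}) (t0 : rat) :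
  k != 0 -> zcoprime k l -> h0 \is a GRing.unit ->
  (exists z, (l - e * k) * (l - e' * k) * (l - e'' * k) * k = z ^+ 2) ->
  h0 * ((l - e * k) * (l - e' * k) * (l - e'' * k)) = r ^+ 2 ->
  zeval k t0 = 0 -> zeval l t0 != 0 ->
  (forall h : {poly int}, (1 < size h)%N -> zsquarefree h ->
     zdvd h ((e - e') * (e - e'')) -> ~ is_square_rat (zeval h t0)) ->
  exists C : {poly rat}, C ^+ 2 = ZtoQ (h0 * (l - e * k)).
Proof.
move=> k0 kl h0u [z Dz] Dr kt lt hyp.
set u := l - e * k in Dz Dr *.
have ut f : zeval (l - f * k) t0 = zeval l t0 by rewrite zevalB zevalM kt mulr0 subr0.
have u0 : u != 0.
  by apply: contraNneq lt => E; rewrite -(ut e) -/u E /zeval rmorph0 horner0.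
have [h [s [Du sqh]]] := zsquarefree_factor u u0.
have s0 : s != 0 by apply: contraNneq u0 => E; rewrite Du E expr0n mulr0.
have [|[m Dm] _] := zsquarefree_part_cofactor h s
  ((l - e' * k) * (l - e'' * k) * k) z s0 sqh.
  by rewrite -Du -Dz; ring.
have coh : zcoprime h k.
  apply: (@zcoprime_dvdl h (s ^+ 2)); rewrite ?expf_neq0 // -Du.
  exact: zcoprime_subM.
(* Modulo [h], l = e k, so the cofactor divisible by [h] becomes k^3 (e - e')(e - e''), and [h] is
   coprime to [k]. *)
have hdvd : zdvd h ((e - e') * (e - e'')).
  do 3!apply: (coh).
  exists (m - k * s ^+ 2 * ((l - e'' * k) + (e - e') * k)).
  have -> : k * (k * (k * ((e - e') * (e - e'')))) =
     (l - e' * k) * (l - e'' * k) * k - k * u * ((l - e'' * k) + (e - e') * k).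
    by rewrite /u; ring.
  by rewrite Dm Du; ring.
have st : zeval s t0 != 0.
  by apply: contraNneq lt => E; rewrite -(ut e) -/u Du zevalM zevalX E expr0n mulr0.
(* As [k] vanishes at [t0], all factors take the value of [l] there: h0 l^3 = r^2 and l = h s^2, so
   h0 h = (r / (l s))^2. *)
have sq : is_square_rat (zeval (h0 * h) t0).
  exists (zeval r t0 / (zeval l t0 * zeval s t0)).
  have := congr1 (zeval^~ t0) Dr; have := congr1 (zeval^~ t0) Du.
  rewrite !(zevalM, zevalX) !ut => E1 E2.
  rewrite expr_div_n -E2 {1}E1; move: st lt => st lt.
  have -> : zeval h t0 = zeval l t0 / zeval s t0 ^+ 2 by rewrite E1; field.
  by field; rewrite st lt.
have [sz1|szh] := ltnP 1 (size (h0 * h)).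
  case: (hyp _ sz1 _ _ sq); first exact: zsquarefree_unit.
  by case: hdvd => q Dq; exists (h0^-1 * q); rewrite mulrACA mulrV // mul1r.
have [c Dc] : exists c, h0 * h = c%:P by exists (h0 * h)`_0; apply: size1_polyC.
case: sq => rho; rewrite Dc /zeval map_polyC hornerC /= => Drho.
exists (rho *: ZtoQ s).
by rewrite Du mulrA Dc rmorphM rmorphXn /= map_polyC /= -Drho exprZn mul_polyC.
Qed.

(** * Rational functions with a pole at [t0] *)

Notation "p %:F" := (@FracField.tofrac _ p).

(** Lowest terms are not demanded, so any representative with these values at [t0] exhibits a
    pole. *)
Definition pole_at (t0 : rat) (f : Qt) := exists p q : {poly rat},
  [/\ f = p%:F / q%:F, q != 0, q.[t0] = 0 & p.[t0] != 0].

Lemma zpoly_to_QtB p q : zpoly_to_Qt (p - q) = zpoly_to_Qt p - zpoly_to_Qt q.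
Proof. by rewrite /zpoly_to_Qt rmorphB tofracB. Qed.

Lemma zpoly_to_QtM p q : zpoly_to_Qt (p * q) = zpoly_to_Qt p * zpoly_to_Qt q.
Proof. by rewrite /zpoly_to_Qt rmorphM tofracM. Qed.

Lemma zpoly_to_QtX p n : zpoly_to_Qt (p ^+ n) = zpoly_to_Qt p ^+ n.
Proof. by rewrite /zpoly_to_Qt rmorphXn tofracXn. Qed.

Lemma zpoly_to_Qt_inj : injective zpoly_to_Qt.
Proof.
move=> p q /eqP; rewrite tofrac_eq => /eqP.
exact: (map_inj_poly (@intr_inj rat) (rmorph0 _)).
Qed.

Lemma zpoly_to_Qt_eq0 p : (zpoly_to_Qt p == 0) = (p == 0).
Proof.
rewrite -(inj_eq zpoly_to_Qt_inj); congr (_ == _).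
by rewrite /zpoly_to_Qt rmorph0 tofrac0.
Qed.

Lemma fraction_repr (R : idomainType) (x : {fraction R}) :
  x = (\n_(repr x))%:F / (\d_(repr x))%:F.
Proof.
have d0 : (\d_(repr x))%:F != 0 by rewrite tofrac_eq0 denom_ratioP.
apply: (mulIf d0); rewrite mulfVK // -{1}[x]reprK; unlock FracField.tofrac.
rewrite -[LHS]FracField.pi_mul; apply/eqmodP; rewrite /= FracField.equivfE /FracField.mulf.
by rewrite !numden_Ratio ?mulr1 ?oner_neq0 ?denom_ratioP // mulrC.
Qed.

Lemma fraction_zpoly (p q : {poly rat}) : q != 0 ->
  exists a b : {poly int}, b != 0 /\ p%:F / q%:F = zpoly_to_Qt a / zpoly_to_Qt b.
Proof.
move=> q0; have [p' [a a0 Dp]] := rat_poly_scale p.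
have [q' [b b0 Dq]] := rat_poly_scale q.
have q'0 : q' != 0 by apply: contraNneq q0 => E; rewrite Dq E rmorph0 scaler0.
have ab0 : (b%:P != 0) /\ (a%:P != 0) by rewrite !polyC_eq0.
exists (b%:P * p'), (a%:P * q'); split; first by rewrite mulf_neq0 ?(proj2 ab0).
have n0 : zpoly_to_Qt (a%:P * q') != 0.
  by rewrite zpoly_to_Qt_eq0 mulf_neq0 ?(proj2 ab0).
have n1 : q%:F != 0 by rewrite tofrac_eq0.
apply/eqP; rewrite (eqr_div _ _ n1 n0); apply/eqP.
rewrite /zpoly_to_Qt -!tofracM; congr (_%:F).
rewrite !rmorphM /= !map_polyC /= Dp Dq -!mul_polyC.
have inv (c : int) : c != 0 -> (c%:~R^-1 : rat)%:P * (c%:~R)%:P = 1.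
  by move=> c0; rewrite -polyCM mulVf ?intr_eq0.
transitivity (ZtoQ p' * ZtoQ q').
  by rewrite mulrACA inv // mul1r.
by rewrite mulrACA [_%:P * _]mulrC inv // mul1r.
Qed.

(** * Kernel points as square data, and their halving *)

(* The data [(B, C1, C2, C3)] encode the kernel point with
   [x - e_i = (C_i / B) ^ 2], the signs of the [C_i] being chosen so that they
   agree at [t0].  It is boolean so that [xchoose] can iterate the halving. *)
Definition halvable (e1 e2 e3 : {poly rat}) (t0 : rat)
    (s : {poly rat} * {poly rat} * {poly rat} * {poly rat}) : bool :=
  let: (B, C1, C2, C3) := s in
  [&& B \is monic, B.[t0] == 0,
      [&& coprimep B C1, coprimep B C2 & coprimep B C3],
      C2 ^+ 2 + e2 * B ^+ 2 == C1 ^+ 2 + e1 * B ^+ 2,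
      C3 ^+ 2 + e3 * B ^+ 2 == C1 ^+ 2 + e1 * B ^+ 2
    & [&& C1.[t0] != 0, C2.[t0] == C1.[t0] & C3.[t0] == C1.[t0]]].

Definition no_square_divisor (e e' e'' : {poly int}) (t0 : rat) :=
  forall h : {poly int}, (1 < size h)%N -> zsquarefree h ->
    zdvd h ((e - e') * (e - e'')) -> ~ is_square_rat (zeval h t0).

(** Both coprimalities are kept: the one over Q controls values and common roots, the one in Z[t]
    drives the descent. *)
Lemma pole_at_zpoly (t0 : rat) (x : Qt) : pole_at t0 x ->
  exists k l : {poly int}, [/\ x = zpoly_to_Qt l / zpoly_to_Qt k, k != 0,
    coprimep k l, zcoprime k l & zeval k t0 = 0 /\ zeval l t0 != 0].
Proof.
move=> [p [q [Dx q0 qt pt]]]; have [a [b [b0 Dab]]] := fraction_zpoly p q q0.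
have [g [k [l [Db Da co kl]]]] := zgcd_split b a b0.
have [g0 k0] : g != 0 /\ k != 0.
  by split; apply: contraNneq b0 => E; rewrite Db E ?(mul0r, mulr0).
have Dlk : x = zpoly_to_Qt l / zpoly_to_Qt k.
  rewrite Dx Dab Da Db !zpoly_to_QtM -mulf_div divff ?mul1r //.
  by rewrite zpoly_to_Qt_eq0.
have kt : zeval k t0 = 0.
  have n1 : q%:F != 0 by rewrite tofrac_eq0.
  have n2 : zpoly_to_Qt k != 0 by rewrite zpoly_to_Qt_eq0.
  have /eqP := Dlk; rewrite Dx (eqr_div _ _ n1 n2).
  rewrite -!tofracM tofrac_eq => /eqP /(congr1 (horner^~ t0)).
  rewrite !hornerM qt mulr0 => /eqP; rewrite mulf_eq0 (negPf pt) => /eqP //.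
exists k, l; split=> //; split=> //.
by apply: coprimep_root (coprimep_ZtoQ k l co) _; apply/rootP.
Qed.

(** Serves to divide the square roots by the leading coefficient [c] of the denominator and to flip
    signs so that all of them take the same value [v] at [t0]. *)
Lemma poly_sign_normalize (F : fieldType) (C : {poly F}) (c t v : F) :
  C.[t] ^+ 2 = (c * v) ^+ 2 -> c != 0 ->
  exists C' : {poly F}, c%:P ^+ 2 * C' ^+ 2 = C ^+ 2 /\ C'.[t] = v.
Proof.
move=> /eqP; rewrite eqf_sqr => vt c0.
have [C1 [E1 E2]] : exists C1, C1 ^+ 2 = C ^+ 2 /\ C1.[t] = c * v.
  case/orP: vt => /eqP E; first by exists C.
  by exists (- C); rewrite sqrrN hornerN E opprK.
exists (c^-1 *: C1); rewrite hornerZ E2 mulKf //; split=> //.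
by rewrite -exprMn mul_polyC scalerA mulfV // scale1r.
Qed.

Lemma curve_clear_denominators (F : fieldType) (A B K L e1 e2 e3 : F) :
  K != 0 -> B != 0 ->
  (A / B) ^+ 2 = (L / K - e1) * (L / K - e2) * (L / K - e3) ->
  (A * K ^+ 2) ^+ 2 =
    B ^+ 2 * ((L - e1 * K) * (L - e2 * K) * (L - e3 * K) * K).
Proof.
move=> K0 B0 E.
have -> : (A * K ^+ 2) ^+ 2 = B ^+ 2 * K ^+ 4 * (A / B) ^+ 2 by field.
by rewrite E; field.
Qed.

Lemma pole_halvable (e1 e2 e3 : {poly int}) (t0 : rat) (x y : Qt) :
  no_square_divisor e1 e2 e3 t0 -> no_square_divisor e2 e1 e3 t0 ->
  no_square_divisor e3 e1 e2 t0 ->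
  on_curve (zpoly_to_Qt e1) (zpoly_to_Qt e2) (zpoly_to_Qt e3) (Some (x, y)) ->
  pole_at t0 x ->
  exists B C1 C2 C3 : {poly rat},
    halvable (ZtoQ e1) (ZtoQ e2) (ZtoQ e3) t0 (B, C1, C2, C3) /\
    x = (C1 ^+ 2 + ZtoQ e1 * B ^+ 2)%:F / (B ^+ 2)%:F.
Proof.
move=> h1 h2 h3 /= xy /pole_at_zpoly [k [l [Dx k0 co kl [kt lt]]]].
have k0' : zpoly_to_Qt k != 0 by rewrite zpoly_to_Qt_eq0.
have [a [b [b0 Dy]]] : exists a b : {poly int},
    b != 0 /\ y = zpoly_to_Qt a / zpoly_to_Qt b.
  by rewrite [y]fraction_repr; apply/fraction_zpoly/denom_ratioP.
have b0' : zpoly_to_Qt b != 0 by rewrite zpoly_to_Qt_eq0.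
(* The product is the square of a rational function; clearing denominators, b^2 divides (a k^2)^2,
   so [b] divides a k^2 and the root lies in Z[t]. *)
have [z Dz] : exists z, (l - e1 * k) * (l - e2 * k) * (l - e3 * k) * k = z ^+ 2.
  have Eab : (a * k ^+ 2) ^+ 2 =
      b ^+ 2 * ((l - e1 * k) * (l - e2 * k) * (l - e3 * k) * k).
    apply: zpoly_to_Qt_inj.
    rewrite !(zpoly_to_QtM, zpoly_to_QtX, zpoly_to_QtB).
    move: xy; rewrite Dx Dy.
    exact: (curve_clear_denominators _ _ _ _ _ _ _ _ k0' b0').
  have [|z Dz] := zdvd_sqr b (a * k ^+ 2) b0; first by eexists; exact: Eab.
  exists z; apply: (mulfI (expf_neq0 2 b0)).
  by rewrite -Eab Dz exprMn.
have [h0 [s0 [r [Dk h0u Dr]]]] := denominator_square e1 e2 e3 k l z k0 kl Dz.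
have [D1 HD1] : exists D : {poly rat}, D ^+ 2 = ZtoQ (h0 * (l - e1 * k)).
  by apply: (factor_square e1 e2 e3 k l h0 r t0) => //; exists z.
have [D2 HD2] : exists D : {poly rat}, D ^+ 2 = ZtoQ (h0 * (l - e2 * k)).
  apply: (factor_square e2 e1 e3 k l h0 r t0) => //; last by rewrite -Dr; ring.
  by exists z; rewrite -Dz; ring.
have [D3 HD3] : exists D : {poly rat}, D ^+ 2 = ZtoQ (h0 * (l - e3 * k)).
  apply: (factor_square e3 e1 e2 k l h0 r t0) => //; last by rewrite -Dr; ring.
  by exists z; rewrite -Dz; ring.
(* The right-hand side is independent of [e], so the three roots agree at [t0] up to sign. *)
have Dt (D e : {poly _}) : D ^+ 2 = ZtoQ (h0 * (l - e * k)) ->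
    D.[t0] ^+ 2 = zeval h0 t0 * zeval l t0.
  move/(congr1 (horner^~ t0)); rewrite horner_exp => ->.
  by rewrite -/(zeval _ t0) zevalM zevalB zevalM kt mulr0 subr0.
(* As k = h0 s0^2, multiplying [l] and [k] by [h0] makes the denominator the square of [B] and each
   numerator the square of some [D]. *)
pose B := ZtoQ (h0 * s0); pose c := lead_coef B.
have HB : B ^+ 2 = ZtoQ (h0 * k) by rewrite -rmorphXn /= Dk; congr ZtoQ; ring.
have hk0 : h0 * k != 0.
  by rewrite mulf_neq0 //; apply: contraTneq h0u => ->; rewrite unitr0.
have ZQ_eq0 p : ZtoQ p = 0 -> p = 0.
  by move=> E; apply/eqP; rewrite -size_poly_eq0 -size_rat_int_poly E size_poly0.
have B0 : B != 0.
  by apply: contra_neq hk0 => E; apply: ZQ_eq0; rewrite -HB E expr0n.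
have c0 : c != 0 by rewrite lead_coef_eq0.
pose v := D1.[t0] / c.
have sgn (D : {poly rat}) e : D ^+ 2 = ZtoQ (h0 * (l - e * k)) ->
    exists C : {poly rat}, c%:P ^+ 2 * C ^+ 2 = D ^+ 2 /\ C.[t0] = v.
  move=> HD; apply: poly_sign_normalize (c0).
  by rewrite /v mulrCA divff // mulr1 (Dt _ _ HD) (Dt _ _ HD1).
have [C1 [HC1 C1t]] := sgn _ _ HD1.
have [C2 [HC2 C2t]] := sgn _ _ HD2.
have [C3 [HC3 C3t]] := sgn _ _ HD3.
pose B' := c^-1 *: B.
have HB' : c%:P ^+ 2 * B' ^+ 2 = ZtoQ (h0 * k).
  by rewrite -exprMn mul_polyC scalerA mulfV // scale1r HB.
have cP0 : c%:P ^+ 2 != 0 :> {poly rat} by rewrite expf_neq0 ?polyC_eq0.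
have sum (C D : {poly rat}) e : c%:P ^+ 2 * C ^+ 2 = D ^+ 2 ->
    D ^+ 2 = ZtoQ (h0 * (l - e * k)) ->
    c%:P ^+ 2 * (C ^+ 2 + ZtoQ e * B' ^+ 2) = ZtoQ (h0 * l).
  move=> HC HD; rewrite mulrDr HC HD mulrCA HB' -rmorphM -rmorphD /=.
  by congr ZtoQ; ring.
have [d d0 Dh0] : exists2 d : rat, d != 0 & ZtoQ h0 = d%:P.
  move: h0u; rewrite poly_unitE => /andP [/size_poly1P [d d0 ->] _].
  by exists d%:~R; rewrite ?intr_eq0 // map_polyC.
have cop (C D : {poly rat}) e : c%:P ^+ 2 * C ^+ 2 = D ^+ 2 ->
    D ^+ 2 = ZtoQ (h0 * (l - e * k)) -> coprimep B' C.
  move=> HC HD; rewrite -(@coprimep_pexpl _ 2) // -(@coprimep_pexpr _ 2) //.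
  apply: (@coprimep_dvdl _ (D ^+ 2)); first by rewrite -HC dvdp_mulIr.
  apply: (@coprimep_dvdr _ (ZtoQ (h0 * k))); first by rewrite -HB' dvdp_mulIr.
  rewrite HD !rmorphM /= Dh0 !mul_polyC coprimepZl // coprimepZr //.
  rewrite rmorphB rmorphM /=; apply: coprimep_subM.
  exact: coprimep_ZtoQ.
have vt : v != 0.
  rewrite mulf_neq0 ?invr_eq0 // -sqrf_eq0 (Dt _ _ HD1).
  by rewrite mulf_neq0 // zeval_unit.
exists B', C1, C2, C3; split.
  apply/and4P; split.
  - by rewrite monicE lead_coefZ mulVf.
  - rewrite hornerZ mulf_eq0 -[B.[t0] == 0]sqrf_eq0 -horner_exp HB -/(zeval _ t0).
    by rewrite zevalM kt mulr0 eqxx orbT.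
  - by rewrite (cop _ _ _ HC1 HD1) (cop _ _ _ HC2 HD2) (cop _ _ _ HC3 HD3).
  - apply/and3P; split.
    + by apply/eqP/(mulfI cP0); rewrite (sum _ _ _ HC1 HD1) (sum _ _ _ HC2 HD2).
    + by apply/eqP/(mulfI cP0); rewrite (sum _ _ _ HC1 HD1) (sum _ _ _ HC3 HD3).
    + by rewrite C1t C2t C3t !eqxx vt.
have B'0 : (B' ^+ 2)%:F != 0.
  by rewrite tofrac_eq0 expf_neq0 // scaler_eq0 invr_eq0 negb_or c0.
rewrite Dx; apply/eqP; rewrite (eqr_div _ _ k0' B'0) -!tofracM tofrac_eq.
apply/eqP/(mulfI cP0); rewrite mulrCA HB' mulrA (sum _ _ _ HC1 HD1) -!rmorphM /=.
by congr ZtoQ; ring.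
Qed.

(** With r_i = C_i / B, the equations say that e_i + r_i^2 is the same for all i; adding r1 r2 + r1
    r3 + r2 r3 gives x - e_i = (r_i + r_j)(r_i + r_k), whose product over i is a square. *)
Lemma halved_point_on_curve (F : fieldType) (B C1 C2 C3 e1 e2 e3 : F) :
  B != 0 ->
  C2 ^+ 2 + e2 * B ^+ 2 = C1 ^+ 2 + e1 * B ^+ 2 ->
  C3 ^+ 2 + e3 * B ^+ 2 = C1 ^+ 2 + e1 * B ^+ 2 ->
  let x := (C1 ^+ 2 + e1 * B ^+ 2 + (C1 * C2 + C1 * C3 + C2 * C3)) / B ^+ 2 in
  let y := (C1 + C2) * (C1 + C3) * (C2 + C3) / B ^+ 3 in
  y ^+ 2 = (x - e1) * (x - e2) * (x - e3).
Proof.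
move=> B0 E2 E3 x y.
have -> : x - e1 = (C1 + C2) * (C1 + C3) / B ^+ 2 by rewrite /x; field.
have -> : x - e2 = (C1 + C2) * (C2 + C3) / B ^+ 2 by rewrite /x -E2; field.
have -> : x - e3 = (C1 + C3) * (C2 + C3) / B ^+ 2 by rewrite /x -E3; field.
by rewrite /y; field.
Qed.

(* [s'] is the half of [s]: [x' - e_1 = (r_1 + r_2)(r_1 + r_3)], [r_i = C_i / B]. *)
Definition halving (s s' : {poly rat} * {poly rat} * {poly rat} * {poly rat}) : bool :=
  let: (B, C1, C2, C3) := s in let: (B', C1', C2', C3') := s' in
  [&& C1' ^+ 2 * B ^+ 2 == (C1 + C2) * (C1 + C3) * B' ^+ 2,
      C2' ^+ 2 * B ^+ 2 == (C1 + C2) * (C2 + C3) * B' ^+ 2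
    & C3' ^+ 2 * B ^+ 2 == (C1 + C3) * (C2 + C3) * B' ^+ 2].

(** The sign choice keeps the pole: the [C_i] agree at [t0], so the numerator of the half takes the
    value 4 C1(t0)^2, which is nonzero, while B^2 vanishes. *)
Lemma halving_exists (e1 e2 e3 : {poly int}) (t0 : rat)
    (s : {poly rat} * {poly rat} * {poly rat} * {poly rat}) :
  no_square_divisor e1 e2 e3 t0 -> no_square_divisor e2 e1 e3 t0 ->
  no_square_divisor e3 e1 e2 t0 ->
  halvable (ZtoQ e1) (ZtoQ e2) (ZtoQ e3) t0 s ->
  exists s', halvable (ZtoQ e1) (ZtoQ e2) (ZtoQ e3) t0 s' && halving s s'.
Proof.
move=> h1 h2 h3; case: s => [[[B C1] C2] C3] /and4P [Bm /eqP Bt _].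
move=> /and3P [/eqP E2 /eqP E3 /and3P [C1t /eqP C2t /eqP C3t]].
have B0 : B != 0 by apply: monic_neq0.
pose S := C1 * C2 + C1 * C3 + C2 * C3.
pose x := (C1 ^+ 2 + ZtoQ e1 * B ^+ 2 + S)%:F / (B ^+ 2)%:F.
pose y := ((C1 + C2) * (C1 + C3) * (C2 + C3))%:F / (B ^+ 3)%:F.
have xy : on_curve (zpoly_to_Qt e1) (zpoly_to_Qt e2) (zpoly_to_Qt e3) (Some (x, y)).
  rewrite /= /x /y /S /zpoly_to_Qt !(tofracD, tofracM, tofracXn).
  apply: halved_point_on_curve; first by rewrite tofrac_eq0.
    by rewrite -!(tofracM, tofracXn, tofracD) E2.
  by rewrite -!(tofracM, tofracXn, tofracD) E3.
have px : pole_at t0 x.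
  exists (C1 ^+ 2 + ZtoQ e1 * B ^+ 2 + S), (B ^+ 2).
  split; first by [].
  - by rewrite expf_neq0.
  - by rewrite horner_exp Bt expr0n.
  rewrite /S !(hornerD, hornerM, horner_exp) Bt C2t C3t.
  have -> : C1.[t0] ^+ 2 + (ZtoQ e1).[t0] * 0 ^+ 2 +
    (C1.[t0] * C1.[t0] + C1.[t0] * C1.[t0] + C1.[t0] * C1.[t0]) = 4%:R * C1.[t0] ^+ 2.
    by ring.
  by rewrite mulf_neq0 // expf_neq0.
have [B' [C1' [C2' [C3' [hs Dx]]]]] := pole_halvable e1 e2 e3 t0 x y h1 h2 h3 xy px.
exists (B', C1', C2', C3'); rewrite hs.
move: hs => /and4P [B'm _ _ /and3P [/eqP E2' /eqP E3' _]].
have B'0 : B' != 0 by apply: monic_neq0.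
have n : (B ^+ 2)%:F != 0 by rewrite tofrac_eq0 expf_neq0.
have n' : (B' ^+ 2)%:F != 0 by rewrite tofrac_eq0 expf_neq0.
move/eqP: Dx; rewrite /x (eqr_div _ _ n n') -!tofracM tofrac_eq => /eqP Dx.
(* Subtracting [e] from both expressions of the abscissa of the half gives (C' / B')^2 = (C^2 + S) /
   B^2, and C_i^2 + S = (C_i + C_j)(C_i + C_k). *)
have fin (e C C' : {poly rat}) : C ^+ 2 + e * B ^+ 2 = C1 ^+ 2 + ZtoQ e1 * B ^+ 2 ->
    C' ^+ 2 + e * B' ^+ 2 = C1' ^+ 2 + ZtoQ e1 * B' ^+ 2 ->
    C' ^+ 2 * B ^+ 2 = (C ^+ 2 + S) * B' ^+ 2.
  move=> E E'; apply: (addIr (e * B' ^+ 2 * B ^+ 2)).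
  by rewrite -mulrDl E' -Dx -E; ring.
rewrite /= (fin _ _ _ erefl erefl) (fin _ _ _ E2 E2') (fin _ _ _ E3 E3').
by apply/and3P; split; apply/eqP; rewrite /S; ring.
Qed.

(** * Termination: no infinite sequence of halvings *)

Lemma dependent_choice (T : choiceType) (P : pred T) (R : rel T) (x0 : T) :
  P x0 -> (forall x, P x -> exists y, P y && R x y) ->
  exists u : nat -> T, forall n, P (u n) /\ R (u n) (u n.+1).
Proof.
move=> Px0 H.
pose nxt (x : {x | P x}) := xchoose (H _ (valP x)).
have nxtP x : P (nxt x) && R (val x) (nxt x) by apply: (xchooseP (H _ (valP x))).
have nxt1 x : P (nxt x) by case/andP: (nxtP x).
pose u n := iter n (fun x => exist (fun x => P x) (nxt x) (nxt1 x))
  (exist (fun x => P x) x0 Px0).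
exists (fun n => val (u n)) => n; split; first exact: valP.
by case/andP: (nxtP (u n)).
Qed.

(** Induction on the initial size: either the size drops somewhere and the chain is restarted there,
    or it is constant and monic associates are equal. *)
Lemma monic_dvd_chain_stable (F : fieldType) (B : nat -> {poly F}) :
  (forall n, B n \is monic) -> (forall n, B n.+1 %| B n) ->
  exists N, forall n, B (N + n)%N = B N.
Proof.
have [m] := ubnP (size (B 0%N)).
elim: m B => // m IHm B; rewrite ltnS => lem mB dB.
have dB0 n : B n %| B 0%N.
  by elim: n => // n IHn; apply: dvdp_trans (dB n) IHn.
have [[n ltn]|eqs] := classic (exists n, (size (B n) < size (B 0%N))%N).
  have [|||N HN] := IHm (fun i => B (n + i)%N).
  - by rewrite addn0; apply: leq_trans ltn lem.
  - by move=> i.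
  - by move=> i; rewrite addnS.
  by exists (n + N)%N => i; rewrite -addnA HN.
exists 0%N => n; rewrite add0n; apply/eqP; rewrite -eqp_monic //.
rewrite -dvdp_size_eqp // eqn_leq dvdp_leq ?monic_neq0 //= leqNgt.
by apply/negP => h; apply: eqs; exists n.
Qed.

(** Over the algebraic numbers [F] splits into linear factors, and a divisor is, up to a scalar, the
    subproduct picked by a boolean mask. Being associates descends to Q. *)
Lemma divisors_finite (F : {poly rat}) : F != 0 ->
  exists k, forall p : nat -> {poly rat}, (forall n, p n %| F) ->
  exists f : nat -> k.-tuple bool, forall i j, f i = f j -> p i %= p j.
Proof.
move=> F0; pose toC := map_poly (ratr : rat -> algC).
have [rs Drs] := closed_field_poly_normal (toC F).
exists (size rs) => p dp.
have f n : {m : (size rs).-tuple bool | toC (p n) %= \prod_(z <- mask m rs) ('X - z%:P)}.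
  have : toC (p n) %| \prod_(z <- rs) ('X - z%:P).
    rewrite -(dvdpZr _ _ (_ : lead_coef (toC F) != 0)) -?Drs ?dvdp_map //.
    by rewrite lead_coef_eq0 map_poly_eq0.
  move=> /dvdp_prod_XsubC [m Dm]; have [m1 /eqP sz E] := resize_mask m rs.
  by exists (Tuple sz); rewrite /= -E.
exists (fun n => sval (f n)) => i j E.
rewrite -(eqp_map (ratr : {rmorphism rat -> algC})).
by apply: (eqp_trans (svalP (f i))); rewrite E eqp_sym; apply: (svalP (f j)).
Qed.

Lemma nat_to_finite_collision (T : finType) (f : nat -> T) :
  exists i j, (i < j)%N /\ f i = f j.
Proof.
have /injectivePn [i [j ij E]] : ~~ injectiveb (fun i : 'I_#|T|.+1 => f i).
  apply/negP => /injectiveP /leq_card; rewrite card_ord.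
  by rewrite ltnn.
case: (ltngtP i j) ij => [lt|gt|/val_inj ->]; rewrite ?eqxx // => _.
- by exists i, j.
- by exists j, i.
Qed.

(** Modulo C^2 the product C'^2 C''^2 is a b B^4, and [B] is coprime to [C]. *)
Lemma coprime_sqr_dvd (F : fieldType) (a b B C C' C'' w : {poly F}) :
  coprimep B C ->
  C' ^+ 2 = C ^+ 2 + a * B ^+ 2 -> C'' ^+ 2 = C ^+ 2 + b * B ^+ 2 ->
  C ^+ 2 * w = C' ^+ 2 * C'' ^+ 2 -> C ^+ 2 %| a * b.
Proof.
move=> co E' E'' E.
rewrite -(@Gauss_dvdpl _ _ (B ^+ 4)); last first.
  by rewrite coprimep_sym coprimep_expl // coprimep_expr.
have -> : a * b * B ^+ 4 = C ^+ 2 * (w - C ^+ 2 - (a + b) * B ^+ 2).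
  by rewrite !mulrBr E E' E''; ring.
exact: dvdp_mulIl.
Qed.

Lemma no_infinite_halving (e1 e2 e3 : {poly rat}) (t0 : rat)
    (u : nat -> {poly rat} * {poly rat} * {poly rat} * {poly rat}) :
  (e1 - e2) * (e1 - e3) != 0 -> (e2 - e1) * (e2 - e3) != 0 ->
  ~ (forall n, halvable e1 e2 e3 t0 (u n) /\ halving (u n) (u n.+1)).
Proof.
move=> n1 n2 H.
pose B n := (u n).1.1.1; pose C1 n := (u n).1.1.2.
pose C2 n := (u n).1.2; pose C3 n := (u n).2.
have Du n : u n = (B n, C1 n, C2 n, C3 n).
  by rewrite /B /C1 /C2 /C3; case: (u n) => [[[]]].
(* By the halving relation B'^2 divides C1'^2 B^2, and [B'] is coprime to [C1']. *)
have dB n : B n.+1 %| B n.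
  have := (H n).2; rewrite !Du => /and3P [/eqP E _ _].
  have := (H n.+1).1; rewrite !Du => /and4P [_ _ /and3P [co _ _] _].
  rewrite -(@dvdp_pexp2r _ _ _ 2) // -(@Gauss_dvdpr _ _ (C1 n.+1 ^+ 2)).
    by rewrite E dvdp_mulIr.
  by rewrite coprimep_expl // coprimep_expr.
have mB n : B n \is monic by have := (H n).1; rewrite Du => /and4P [].
have [N HN] := monic_dvd_chain_stable _ B mB dB.
have B0 : B N ^+ 2 != 0 by rewrite expf_neq0 // monic_neq0.
have eqs n (m := (N + n)%N) : [/\ C2 m ^+ 2 + e2 * B N ^+ 2 = C1 m ^+ 2 + e1 * B N ^+ 2,
    C3 m ^+ 2 + e3 * B N ^+ 2 = C1 m ^+ 2 + e1 * B N ^+ 2,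
    coprimep (B N) (C1 m) /\ coprimep (B N) (C2 m)
    & [/\ (C1 m).[t0] != 0, (C2 m).[t0] = (C1 m).[t0] & (C3 m).[t0] = (C1 m).[t0]]].
  have := (H m).1; rewrite Du HN => /and4P [_ _ /and3P [-> -> _]].
  by move=> /and3P [/eqP -> /eqP -> /and3P [-> /eqP -> /eqP ->]].
have stp n (m := (N + n)%N) : [/\ C1 m.+1 ^+ 2 = (C1 m + C2 m) * (C1 m + C3 m),
    C2 m.+1 ^+ 2 = (C1 m + C2 m) * (C2 m + C3 m)
    & C3 m.+1 ^+ 2 = (C1 m + C3 m) * (C2 m + C3 m)].
  have := (H m).2; rewrite !Du -addnS !HN => /and3P [/eqP h1 /eqP h2 /eqP h3].
  by split; apply: (mulIf B0).
have pow n : (C1 (N + n)%N).[t0] ^+ 2 = 4%:R ^+ n * (C1 N).[t0] ^+ 2.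
  elim: n => [|n IHn]; first by rewrite addn0 expr0 mul1r.
  have [+ _ _] := stp n; move/(congr1 (horner^~ t0)).
  rewrite addnS horner_exp hornerM !hornerD => ->.
  have [_ _ _ [_ -> ->]] := eqs n.
  by rewrite exprS -mulrA -IHn; ring.
(* With [B] stable, C2'^2 C3'^2 = C1'^2 (C2 + C3)^2 relates a term to its predecessor, hence the
   index [n.+1]. *)
have dv1 n : C1 (N + n.+1)%N %| (e1 - e2) * (e1 - e3).
  apply: (@dvdp_trans _ (C1 (N + n.+1)%N ^+ 2)); first exact: dvdp_exp.
  have [E2 E3 [co1 co2] _] := eqs n.+1; have [s1 s2 s3] := stp n.
  apply: (coprime_sqr_dvd _ _ _ (B N) _ (C2 (N + n.+1)%N) (C3 (N + n.+1)%N)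
    ((C2 (N + n)%N + C3 (N + n)%N) ^+ 2)) => //.
  - by apply: (addIr (e2 * B N ^+ 2)); rewrite E2; ring.
  - by apply: (addIr (e3 * B N ^+ 2)); rewrite E3; ring.
  - by rewrite addnS s1 s2 s3; ring.
have dv2 n : C2 (N + n.+1)%N %| (e2 - e1) * (e2 - e3).
  apply: (@dvdp_trans _ (C2 (N + n.+1)%N ^+ 2)); first exact: dvdp_exp.
  have [E2 E3 [co1 co2] _] := eqs n.+1; have [s1 s2 s3] := stp n.
  apply: (coprime_sqr_dvd _ _ _ (B N) _ (C1 (N + n.+1)%N) (C3 (N + n.+1)%N)
    ((C1 (N + n)%N + C3 (N + n)%N) ^+ 2)) => //.
  - by apply: (addIr (e1 * B N ^+ 2)); rewrite -E2; ring.
  - by apply: (addIr (e3 * B N ^+ 2)); rewrite E3 -E2; ring.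
  - by rewrite addnS s1 s2 s3; ring.
have [k1 fin1] := divisors_finite _ n1; have [k2 fin2] := divisors_finite _ n2.
have [f1 inj1] := fin1 _ dv1; have [f2 inj2] := fin2 _ dv2.
have [i [j [ltij [E1 E2]]]] := nat_to_finite_collision _ (fun n => (f1 n, f2 n)).
have assoc (p q : {poly rat}) : p %= q -> exists a, p = a *: q.
  move=> /eqpP [[a b] /= /andP [a0 b0] E]; exists (a^-1 * b).
  by rewrite -scalerA -E scalerA mulVf // scale1r.
have [a Ha] := assoc _ _ (inj1 _ _ E1); have [b Hb] := assoc _ _ (inj2 _ _ E2).
have [A2i _ _ [C1i C2i _]] := eqs i.+1; have [A2j _ _ [C1j C2j _]] := eqs j.+1.
(* [C1] and [C2] agree at [t0] in both terms, so the two proportionality factors coincide. *)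
have eab : b = a.
  by apply: (mulIf C1j); rewrite -{1}C2j -!hornerZ -Ha -Hb.
(* C2^2 - C1^2 = (e1 - e2) B^2 is the same nonzero polynomial for both terms, yet it scales by
   a^2. *)
have a1 : a ^+ 2 = 1.
  have e12 : e1 - e2 != 0 by apply: contraNneq n1 => ->; rewrite mul0r.
  have dif n : C2 (N + n)%N ^+ 2 - C1 (N + n)%N ^+ 2 = (e1 - e2) * B N ^+ 2.
    have [A2 _ _ _] := eqs n.
    by apply: (addIr (e2 * B N ^+ 2)); rewrite addrAC A2; ring.
  have nz : (e1 - e2) * B N ^+ 2 != 0 by rewrite mulf_neq0.
  apply: polyC_inj; apply: (mulIf nz); rewrite polyC1 mul1r.
  by rewrite -{1}(dif j.+1) -(dif i.+1) Ha Hb eab !exprZn mul_polyC scalerBr.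
have := pow i.+1; rewrite Ha hornerZ exprMn a1 mul1r pow.
have v0 : (C1 N).[t0] ^+ 2 != 0.
  by have [_ _ _ []] := eqs 0%N; rewrite addn0 => v0 _ _; rewrite expf_neq0.
move/(mulIf v0)/ieexprIn => /(_ isT isT) /eqP.
by rewrite eqSS gtn_eqF.
Qed.

Lemma no_pole (e1 e2 e3 : {poly int}) (t0 : rat) (x y : Qt) :
  zeval ((e1 - e2) * (e2 - e3) * (e3 - e1)) t0 != 0 ->
  no_square_divisor e1 e2 e3 t0 -> no_square_divisor e2 e1 e3 t0 ->
  no_square_divisor e3 e1 e2 t0 ->
  on_curve (zpoly_to_Qt e1) (zpoly_to_Qt e2) (zpoly_to_Qt e3) (Some (x, y)) ->
  ~ pole_at t0 x.
Proof.
move=> d0 h1 h2 h3 xy px.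
have [B [C1 [C2 [C3 [hs _]]]]] := pole_halvable _ _ _ _ _ _ h1 h2 h3 xy px.
have [u Hu] := dependent_choice _ _ _ _ hs
  (fun s => halving_exists e1 e2 e3 t0 s h1 h2 h3).
have neq : [/\ ZtoQ e1 - ZtoQ e2 != 0, ZtoQ e2 - ZtoQ e3 != 0 & ZtoQ e3 - ZtoQ e1 != 0].
  by move: d0; rewrite /zeval !rmorphM !rmorphB /= => d0; split;
    apply: contraNneq d0 => ->; rewrite ?(mul0r, mulr0) horner0.
have [n12 n23 n31] := neq.
apply: no_infinite_halving Hu; rewrite mulf_neq0 //; rewrite -oppr_eq0 opprB //.
Qed.

(** * Values of rational functions at [t0] *)

(** A relation on arbitrary representatives, so that sums and products can be evaluated without
    reducing fractions; [fevP] links it to [fev]. *)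
Definition value_at (t0 : rat) (f : Qt) (v : rat) := exists p q : {poly rat},
  [/\ f = p%:F / q%:F, q.[t0] != 0 & p.[t0] = v * q.[t0]].

Lemma horner_neq0 (p : {poly rat}) t0 : p.[t0] != 0 -> p != 0.
Proof. by apply: contraNneq => ->; rewrite horner0. Qed.

Lemma frac_neq0 (p : {poly rat}) t0 : p.[t0] != 0 -> p%:F != 0.
Proof. by move/horner_neq0; rewrite tofrac_eq0. Qed.

Lemma value_atN t0 f v : value_at t0 f v -> value_at t0 (- f) (- v).
Proof.
move=> [p [q [-> q0 E]]]; exists (- p), q; split=> //.
  by rewrite tofracN mulNr.
by rewrite hornerN E mulNr.
Qed.

Lemma value_atD t0 f g v w :
  value_at t0 f v -> value_at t0 g w -> value_at t0 (f + g) (v + w).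
Proof.
move=> [p [q [-> q0 E]]] [p' [q' [-> q'0 E']]].
exists (p * q' + p' * q), (q * q'); split.
- by rewrite addf_div ?(frac_neq0 _ t0) // !(tofracM, tofracD).
- by rewrite hornerM mulf_neq0.
- by rewrite hornerD !hornerM E E'; ring.
Qed.

Lemma value_atM t0 f g v w :
  value_at t0 f v -> value_at t0 g w -> value_at t0 (f * g) (v * w).
Proof.
move=> [p [q [-> q0 E]]] [p' [q' [-> q'0 E']]].
exists (p * p'), (q * q'); split.
- by rewrite mulf_div !tofracM.
- by rewrite hornerM mulf_neq0.
- by rewrite !hornerM E E'; ring.
Qed.

Lemma value_at_zpoly t0 e : value_at t0 (zpoly_to_Qt e) (zeval e t0).
Proof.
exists (ZtoQ e), 1; rewrite hornerC mulr1 oner_neq0; split=> //.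
by rewrite tofrac1 divr1.
Qed.

Lemma value_at_neq0 t0 f v : value_at t0 f v -> v != 0 -> f != 0.
Proof.
move=> [p [q [-> q0 E]]] v0; rewrite mulf_neq0 ?invr_eq0 ?(frac_neq0 _ t0) //.
by rewrite E mulf_neq0.
Qed.

Lemma value_pole_at t0 f v : value_at t0 f v -> ~ pole_at t0 f.
Proof.
move=> [p [q [-> q0 E]]] [p' [q' [+ q'0 q't p't]]].
have n : q'%:F != 0 by rewrite tofrac_eq0.
move/eqP; rewrite (eqr_div _ _ (frac_neq0 _ _ q0) n) -!tofracM tofrac_eq => /eqP.
move/(congr1 (horner^~ t0))/eqP; rewrite !hornerM q't mulr0 eq_sym mulf_eq0.
by rewrite (negPf q0) (negPf p't).
Qed.

Lemma pole_atM t0 f g : pole_at t0 f -> pole_at t0 g -> pole_at t0 (f * g).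
Proof.
move=> [p [q [-> q0 qt pt]]] [p' [q' [-> q'0 q't p't]]].
exists (p * p'), (q * q'); split.
- by rewrite mulf_div !tofracM.
- by rewrite mulf_neq0.
- by rewrite hornerM qt mul0r.
- by rewrite hornerM mulf_neq0.
Qed.

Lemma pole_atD t0 f g w : pole_at t0 f -> value_at t0 g w -> pole_at t0 (f + g).
Proof.
move=> [p [q [-> q0 qt pt]]] [p' [q' [-> q't E]]].
have n : q%:F != 0 by rewrite tofrac_eq0.
exists (p * q' + p' * q), (q * q'); split.
- by rewrite (addf_div _ _ n (frac_neq0 _ _ q't)) !(tofracM, tofracD).
- by rewrite mulf_neq0 // (horner_neq0 _ t0).
- by rewrite hornerM qt mul0r.
- by rewrite hornerD !hornerM qt mulr0 addr0 mulf_neq0.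
Qed.

Lemma pole_at_div t0 f g v :
  value_at t0 f v -> v != 0 -> value_at t0 g 0 -> g != 0 -> pole_at t0 (f / g).
Proof.
move=> [p [q [-> q0 E]]] v0 [p' [q' [-> q'0 E']]] g0.
have p'0 : p' != 0 by apply: contraNneq g0 => ->; rewrite tofrac0 mul0r.
exists (p * q'), (q * p'); split.
- by rewrite invf_div mulf_div !tofracM.
- by rewrite mulf_neq0 // (horner_neq0 _ t0).
- by rewrite hornerM E' mul0r mulr0.
- by rewrite hornerM E !mulf_neq0.
Qed.

Lemma fevP t0 f :
  if fev t0 f is Some v then value_at t0 f v else pole_at t0 f.
Proof.
rewrite /fev; set p := \n_(repr f); set q := \d_(repr f).
have q0 : q != 0 by apply: denom_ratioP.
set g := gcdp p q.
have g0 : g != 0 by rewrite gcdp_eq0 negb_and q0 orbT.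
have Dp : p %/ g * g = p by rewrite divpK ?dvdp_gcdl.
have Dq : q %/ g * g = q by rewrite divpK ?dvdp_gcdr.
have q'0 : q %/ g != 0 by apply: contraNneq q0 => E; rewrite -Dq E mul0r.
have Df : f = (p %/ g)%:F / (q %/ g)%:F.
  rewrite [LHS]fraction_repr -/p -/q -{1}Dp -{1}Dq !tofracM -mulf_div divff ?mulr1 //.
  by rewrite tofrac_eq0.
have co : coprimep (q %/ g) (p %/ g).
  by rewrite coprimep_sym; apply: coprimep_div_gcd; rewrite q0 orbT.
case: ifPn => [/eqP qt|qt]; exists (p %/ g), (q %/ g); split=> //.
  by apply: coprimep_root co _; apply/rootP.
by rewrite divfK.
Qed.

Lemma value_at_uniq t0 f v w : value_at t0 f v -> value_at t0 f w -> v = w.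
Proof.
move=> fv fw; have V0 := value_atD _ _ _ _ _ fv (value_atN _ _ _ fw).
apply/eqP; rewrite -subr_eq0; apply/negPn/negP => /(value_at_neq0 _ _ _ V0).
by rewrite subrr eqxx.
Qed.

(** * Differences of points with equal specialization, and injectivity *)

(* The chord or tangent of slope [s] through (x, y) and (x', -y'). *)
Lemma chord_third_point (F : fieldType) (e1 e2 e3 x y x' y' s : F) :
  y ^+ 2 = (x - e1) * (x - e2) * (x - e3) ->
  s * (x - x') = y + y' ->
  s * (y - y') = (x - e1) * (x - e2) + (x - e1) * (x' - e3) + (x' - e2) * (x' - e3) ->
  let X := s * s + (e1 + e2 + e3 - x - x') in
  (s * (X - x) + y) ^+ 2 = (X - e1) * (X - e2) * (X - e3).
Proof.
move=> Ey E1 E2 X.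
have Z : s * (y - y') - 2%:R * s * y + s * (s * (x - x')) = 0 by rewrite E1; ring.
apply/eqP; rewrite eq_sym -subr_eq0; apply/eqP.
(* [X] comes from Vieta's formula for the sum of the roots; given the other two relations, the sides
   differ by X - x times an expression killed by s (x - x') = y + y'. *)
transitivity ((X - x) * (s * (y - y') - 2%:R * s * y + s * (s * (x - x')))).
  by rewrite E2 sqrrD Ey /X; ring.
by rewrite Z mulr0.
Qed.

(** Gives the slope in two forms, with denominator x - x' or y - y', so that one survives when the
    other is indeterminate at [t0]. *)
Lemma curve_difference (F : fieldType) (e1 e2 e3 x y x' y' : F) :
  y ^+ 2 = (x - e1) * (x - e2) * (x - e3) ->
  y' ^+ 2 = (x' - e1) * (x' - e2) * (x' - e3) ->
  (y + y') * (y - y') = (x - x') *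
    ((x - e1) * (x - e2) + (x - e1) * (x' - e3) + (x' - e2) * (x' - e3)).
Proof. by move=> E E'; rewrite mulrC -subr_sqr E E'; ring. Qed.

(** The slope [s] of the line defining the difference has a pole at [t0], hence so has X, which is
    s^2 plus a function regular at [t0]. A zero denominator in the slope forces the points to be
    equal. *)
Lemma difference_pole (e1 e2 e3 : {poly int}) (t0 : rat) (x y x' y' : Qt) (a b : rat) :
  zeval ((e1 - e2) * (e2 - e3) * (e3 - e1)) t0 != 0 ->
  on_curve (zpoly_to_Qt e1) (zpoly_to_Qt e2) (zpoly_to_Qt e3) (Some (x, y)) ->
  on_curve (zpoly_to_Qt e1) (zpoly_to_Qt e2) (zpoly_to_Qt e3) (Some (x', y')) ->
  value_at t0 x a -> value_at t0 x' a -> value_at t0 y b -> value_at t0 y' b ->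
  (x, y) = (x', y') \/
  exists X Y : Qt, pole_at t0 X /\
    on_curve (zpoly_to_Qt e1) (zpoly_to_Qt e2) (zpoly_to_Qt e3) (Some (X, Y)).
Proof.
rewrite /= !(zevalM, zevalB).
have := value_at_zpoly t0 e1; have := value_at_zpoly t0 e2; have := value_at_zpoly t0 e3.
move: (zpoly_to_Qt e1) (zpoly_to_Qt e2) (zpoly_to_Qt e3) => E1 E2 E3.
move: (zeval e1 t0) (zeval e2 t0) (zeval e3 t0) => c1 c2 c3.
move=> V3 V2 V1 dis Ey Ey' Vx Vx' Vy Vy'.
have VB f g v w : value_at t0 f v -> value_at t0 g w -> value_at t0 (f - g) (v - w).
  by move=> Vf Vg; apply: value_atD => //; apply: value_atN.
pose g := (x - E1) * (x - E2) + (x - E1) * (x' - E3) + (x' - E2) * (x' - E3).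
have fact : (y + y') * (y - y') = (x - x') * g.
  exact: curve_difference.
have slope s : s * (x - x') = y + y' -> s * (y - y') = g -> pole_at t0 s ->
    exists X Y : Qt, pole_at t0 X /\ Y ^+ 2 = (X - E1) * (X - E2) * (X - E3).
  move=> S1 S2 ps.
  exists (s * s + (E1 + E2 + E3 - x - x')); eexists; split; last first.
    exact: chord_third_point Ey S1 S2.
  apply: pole_atD; first exact: pole_atM.
  by apply: (VB) Vx'; apply: (VB) Vx; apply: value_atD V3; apply: value_atD V1 V2.
(* If b is nonzero, y + y' takes the value 2 b at [t0] while x - x' vanishes there; otherwise the
   second form of the slope is used. *)
have [b0|b0] := eqVneq b 0; last first.
  have sy : value_at t0 (y + y') (b + b) by apply: value_atD.
  have b20 : b + b != 0 by rewrite -mulr2n mulrn_eq0.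
  have sy0 := value_at_neq0 _ _ _ sy b20.
  have [Exx|nxx] := eqVneq (x - x') 0.
    left; move/eqP: fact; rewrite Exx mul0r mulf_eq0 (negPf sy0) subr_eq0 => /eqP ->.
    by move/eqP: Exx; rewrite subr_eq0 => /eqP ->.
  right; apply: (slope ((y + y') / (x - x'))).
  - by rewrite divfK.
  - by rewrite mulrAC fact mulrAC divff // mul1r.
  - by apply: pole_at_div sy b20 _ nxx; rewrite -(subrr a); apply: VB.
have Vg : value_at t0 g ((a - c1) * (a - c2) + (a - c1) * (a - c3) + (a - c2) * (a - c3)).
  by apply: value_atD; first apply: value_atD; apply: value_atM; apply: (VB).
have root_a : (a - c1) * (a - c2) * (a - c3) = 0.
  have Vy2 : value_at t0 (y ^+ 2) 0 by rewrite expr2 -(mul0r b) -{1}b0; apply: value_atM.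
  apply: (value_at_uniq t0 (y ^+ 2)) (Vy2); rewrite Ey.
  apply: value_atM; last exact: VB.
  by apply: value_atM; apply: (VB).
(* This is the derivative of the specialized cubic at its root [a], nonzero because the roots [c1],
   [c2], [c3] are distinct. *)
have g0 : (a - c1) * (a - c2) + (a - c1) * (a - c3) + (a - c2) * (a - c3) != 0.
  move: dis; rewrite !mulf_eq0 !negb_or => /andP [/andP [d12 d23] d31].
  have [d21 d32 d13] : [/\ c2 - c1 != 0, c3 - c2 != 0 & c1 - c3 != 0].
    by rewrite -![_ - _ == 0]oppr_eq0 !opprB.
  move/eqP: root_a; rewrite !mulf_eq0 !subr_eq0 -orbA.
  by case/or3P => /eqP ->; rewrite subrr ?(mul0r, mulr0, add0r, addr0) mulf_neq0.
have [Eyy|nyy] := eqVneq (y - y') 0.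
  left; move/eqP: fact; rewrite Eyy mulr0 eq_sym mulf_eq0.
  rewrite (negPf (value_at_neq0 _ _ _ Vg g0)) orbF subr_eq0 => /eqP ->.
  by move/eqP: Eyy; rewrite subr_eq0 => /eqP ->.
right; apply: (slope (g / (y - y'))).
- by rewrite mulrAC [g * _]mulrC -fact mulfK.
- by rewrite divfK.
- by apply: pole_at_div Vg g0 _ nyy; rewrite -(subrr b); apply: VB.
Qed.

Theorem theorem2p2 (e1 e2 e3 : {poly int}) (t0 : rat) :
  ~ constant_curve e1 e2 e3 ->
  zeval ((e1 - e2) * (e2 - e3) * (e3 - e1)) t0 != 0 ->
  (forall h : {poly int},
      (1 < size h)%N -> zsquarefree h ->
      zdvd h ((e1 - e2) * (e1 - e3)) \/ zdvd h ((e2 - e1) * (e2 - e3))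
        \/ zdvd h ((e3 - e1) * (e3 - e2)) ->
      ~ is_square_rat (zeval h t0)) ->
  forall P Q : option (Qt * Qt),
    on_curve (zpoly_to_Qt e1) (zpoly_to_Qt e2) (zpoly_to_Qt e3) P ->
    on_curve (zpoly_to_Qt e1) (zpoly_to_Qt e2) (zpoly_to_Qt e3) Q ->
    specialize t0 P = specialize t0 Q -> P = Q.
Proof.
move=> _ dis hyp.
have h1 : no_square_divisor e1 e2 e3 t0 by move=> h sz sq dv; apply: hyp => //; left.
have h2 : no_square_divisor e2 e1 e3 t0.
  by move=> h sz sq dv; apply: hyp => //; right; left.
have h3 : no_square_divisor e3 e1 e2 t0.
  by move=> h sz sq dv; apply: hyp => //; right; right.
have np x y := no_pole e1 e2 e3 t0 x y dis h1 h2 h3.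
(* An affine point stays affine: x has no pole by [np], and a pole of y would be a pole of y^2, a
   product of functions regular at [t0]. *)
have spec x y :
    on_curve (zpoly_to_Qt e1) (zpoly_to_Qt e2) (zpoly_to_Qt e3) (Some (x, y)) ->
    exists a b, [/\ value_at t0 x a, value_at t0 y b
      & specialize t0 (Some (x, y)) = Some (a, b)].
  move=> xy; rewrite /specialize; have := fevP t0 x; have := fevP t0 y.
  case: (fev t0 x) => [a|] + Vx; last by case: (np _ _ xy).
  case: (fev t0 y) => [b|] Vy; first by exists a, b.
  have := pole_atM _ _ _ Vy Vy; rewrite -expr2 [_ ^+ 2]xy => py.
  have Vxe e : value_at t0 (x - zpoly_to_Qt e) (a - zeval e t0).
    by apply: value_atD Vx _; apply/value_atN/value_at_zpoly.
  have V3 := value_atM _ _ _ _ _ (value_atM _ _ _ _ _ (Vxe e1) (Vxe e2)) (Vxe e3).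
  by case: (value_pole_at _ _ _ V3 py).
case=> [[x y]|] [[x' y']|] // cP cQ.
- have [a [b [Vx Vy ->]]] := spec _ _ cP; have [a' [b' [Vx' Vy' ->]]] := spec _ _ cQ.
  case=> Ea Eb; rewrite -Ea in Vx'; rewrite -Eb in Vy'.
  have [-> //|[X [Y [pX cX]]]] :=
    difference_pole _ _ _ _ _ _ _ _ _ _ dis cP cQ Vx Vx' Vy Vy'.
  by case: (np _ _ cX).
- by have [a [b [_ _ ->]]] := spec _ _ cP.
- by have [a [b [_ _ ->]]] := spec _ _ cQ.
Qed.
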